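(* Let $d\in\mathbb{N}$, let $P$ be a stationary and ergodic probability measure on $\Omega=[0,1]^{\mathcal{K}^d}$, and fix an integer $0\le q<d$. For each $t\in[0,1]$ let $\widehat\beta_q(t)$ be the non-random constant such that $|\Lambda_n|^{-1}\beta_q^n(t)\to\widehat\beta_q(t)$ almost surely (such a constant exists for every $t$). Assume that for every $Q\in\mathcal{K}^d$ the marginal distribution function $F^Q(t)=P(\omega_Q\le t)$ is continuous in $t\in[0,1]$. Then $$\lim_{n\to\infty}\sup_{t\in[0,1]}\Big|\frac{1}{|\Lambda_n|}\beta_q^n(t)-\widehat\beta_q(t)\Big|=0\quad\text{almost surely.}$$
   Context: An elementary interval is a closed interval $[l,l+1]$ or a degenerate interval $[l]=[l,l]$ with $l\in\mathbb{Z}$. An elementary cube in $\mathbb{R}^d$ is a product $Q=I_1\times\cdots\times I_d$ of elementary intervals; its dimension is the number of nondegenerate factors. $\mathcal{K}^d$ denotes the set of all elementary cubes in $\mathbb{R}^d$. A cubical set is a (possibly infinite) union of elementary cubes. For a cubical set $X$, the cubical chain complex has $C_k(X)$ the free $\mathbb{Z}$-module generated by the $k$-dimensional elementary cubes contained in $X$, with the standard cubical boundary operator; $H_k(X)$ is its homology, and for bounded $X$, $\beta_k(X)$ is the rank of the free part of $H_k(X)$. Random model: $\Omega=[0,1]^{\mathcal{K}^d}$ with product topology and Borel $\sigma$-field; $\omega=(\omega_Q)_{Q\in\mathcal{K}^d}$. Translations $\tau_x\omega=(\omega_{-x+Q})_Q$, $x\in\mathbb{Z}^d$; stationarity means $P\circ\tau_x^{-1}=P$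 for all $x$, ergodicity means translation-invariant events have probability $0$ or $1$. For $t\in[0,1]$, $X(t)=\bigcup\{Q\in\mathcal{K}^d:\omega_Q\le t\}$, $\Lambda_n=[-n,n]^d$, $X^n(t)=X(t)\cap\Lambda_n$, $\beta_q^n(t)=\beta_q(X^n(t))$, $|\Lambda_n|=(2n)^d$ its Lebesgue measure. *)

(* Defs.v *)
From HB Require Import structures.
From mathcomp Require Import all_boot all_order all_algebra.
From mathcomp Require Import all_classical all_reals all_analysis.
Set Implicit Arguments. Unset Strict Implicit. Unset Printing Implicit Defensive.
Import Order.TTheory GRing.Theory Num.Theory.
Import numFieldNormedType.Exports.
Local Open Scope classical_set_scope.
Local Open Scope ring_scope.

(* An elementary interval is encoded as (l, b) : int * bool :
   (l, true)  denotes [l, l+1]  (nondegenerate),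
   (l, false) denotes [l] = [l, l] (degenerate).
   An elementary cube in R^d is a d-tuple of elementary intervals. *)
Definition cube (d : nat) := {ffun 'I_d -> int * bool}.

Definition cube_dim d (Q : cube d) : nat := #|[pred i | (Q i).2]|.

Definition point (R : realType) (d : nat) := 'I_d -> R.

Definition cube_set (R : realType) d (Q : cube d) : set (point R d) :=
  [set x : point R d | forall i : 'I_d,
     if (Q i).2 then ((Q i).1%:~R <= x i <= ((Q i).1 + 1)%:~R)
     else x i == (Q i).1%:~R].

Definition cube_shift d (x : {ffun 'I_d -> int}) (Q : cube d) : cube d :=
  [ffun i => ((Q i).1 + x i, (Q i).2)].

Definition chain d := cube d -> int.

Definition is_chain (R : realType) d (X : set (point R d)) (k : nat)
  (c : chain d) : Prop :=
  finite_set [set Q | c Q != 0] /\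
  forall Q, c Q != 0 -> cube_dim Q = k /\ @cube_set R _ Q `<=` X.

Definition set_slot d (Q : cube d) (i : 'I_d) (I : int * bool) : cube d :=
  [ffun j => if j == i then I else Q j].

Definition bd_sign d (Q : cube d) (i : 'I_d) : int :=
  (-1) ^+ #|[pred j : 'I_d | (j < i)%N && (Q j).2]|.

Definition elem_bd d (Q : cube d) : chain d := fun P =>
  \sum_(i < d | (Q i).2)
     bd_sign Q i * ((P == set_slot Q i ((Q i).1 + 1, false))%:R
                  - (P == set_slot Q i ((Q i).1, false))%:R).

(* boundary operator on chains, linear extension of elem_bd:
   (dc)(P) = sum_Q c(Q) * <dQ, P>.  Only the (finitely many) cubes Q having P
   as a codimension-one face contribute; these are enumerated explicitly. *)
Definition chain_bd d (c : chain d) : chain d := fun P =>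
  \sum_(i < d | ~~ (P i).2)
    (c (set_slot P i ((P i).1 - 1, true)) *
       elem_bd (set_slot P i ((P i).1 - 1, true)) P
   + c (set_slot P i ((P i).1, true)) *
       elem_bd (set_slot P i ((P i).1, true)) P).

(* r homology classes of H_q(X) given by cycles z_1..z_r that are
   Z-linearly independent in H_q(X) = Z_q(X) / B_q(X) *)
Definition indep_classes (R : realType) d (X : set (point R d)) (q r : nat)
  : Prop :=
  exists z : 'I_r -> chain d,
    (forall i, is_chain X q (z i) /\ chain_bd (z i) = (fun _ => 0)) /\
    forall a : 'I_r -> int,
      (exists c, is_chain X q.+1 c /\
         (fun P => \sum_(i < r) a i * z i P) = chain_bd c) ->
      forall i, a i = 0.

(* beta_q(X): rank of the free part of H_q(X) (= maximal number of
   Z-independent elements of H_q(X)); meaningful for bounded X. *)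
Definition betti (R : realType) d (X : set (point R d)) (q : nat) : nat :=
  xget 0%N [set r | indep_classes X q r /\
                    forall s, indep_classes X q s -> (s <= r)%N].

Definition config (R : realType) d := cube d -> R.

Definition coord_sets (R : realType) d : set (set (config R d)) :=
  [set (fun w : config R d => w Q) @^-1` B | Q in [set: cube d] &
      B in [set B : set R | measurable B]].

Definition Omega (R : realType) d := g_sigma_algebraType (@coord_sets R d).

Definition unit_configs (R : realType) d : set (Omega R d) :=
  [set w | forall Q, 0 <= w Q <= 1].

Definition tau (R : realType) d (x : {ffun 'I_d -> int}) (w : Omega R d)
  : Omega R d := fun Q => w (cube_shift [ffun i => - x i] Q).

Definition stationary (R : realType) d (P : probability (Omega R d) R) :=
  forall x (A : set (Omega R d)), measurable A -> P (tau x @^-1` A) = P A.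

Definition ergodic (R : realType) d (P : probability (Omega R d) R) :=
  forall A : set (Omega R d), measurable A ->
    (forall x, tau x @^-1` A = A) -> P A = 0%E \/ P A = 1%E.

Definition Xt (R : realType) d (w : Omega R d) (t : R) : set (point R d) :=
  \bigcup_(Q in [set Q | w Q <= t]) @cube_set R _ Q.

Definition Lambda (R : realType) d (n : nat) : set (point R d) :=
  [set x | forall i, - (n%:R) <= x i <= n%:R].

Definition vol_Lambda (R : realType) d (n : nat) : R := (2 * n%:R) ^+ d.

Definition beta_n (R : realType) d (q : nat) (w : Omega R d) (n : nat) (t : R)
  : nat := betti (Xt w t `&` @Lambda R d n) q.

Definition marginal_cdf (R : realType) d (P : probability (Omega R d) R)
  (Q : cube d) (t : R) : R := fine (P [set w : Omega R d | w Q <= t]).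

(* Main.v *)
Require Import Defs.
From HB Require Import structures.
From mathcomp Require Import all_boot all_order all_algebra.
From mathcomp Require Import all_classical all_reals all_analysis.
From mathcomp Require Import measurable_realfun.
From mathcomp Require Import zify ring lra.
Set Implicit Arguments. Unset Strict Implicit. Unset Printing Implicit Defensive.
Import Order.TTheory GRing.Theory Num.Theory.
Import numFieldNormedType.Exports.
Local Open Scope classical_set_scope.
Local Open Scope ring_scope.

(* If X is a subset of Y, then |beta_q(X) - beta_q(Y)| is at most the number of
   q- and (q+1)-cubes of Y not in X. Hence for s <= t in a cell [s, u] the number
   |beta_q^n(t) - beta_q^n(s)| is at most 4^d times the number of cubes of
   Lambda_(n+1) whose birth time lies in ]s, u]. Continuity of the marginals gives
   a finite grid on which such a birth has small probability p. The pointwise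
   ergodic theorem is not needed to bound the density of these cubes: the event
   that some translate has density above c infinitely often is exactly invariant,
   and by the weak-type maximal inequality (Vitali covering and transference) its
   probability is below 1 as soon as c exceeds a constant times p, so it is null
   by ergodicity. The theorem then reduces to convergence at the grid points. *)

(** * Betti numbers and inclusion of cubical sets *)

(** Over the rationals the rank is at most [m], so the left kernel is nonzero; clearing the
    denominators of a kernel vector gives an integer one. *)
Lemma int_matrix_left_kernel (r m : nat) (M : 'M[int]_(r, m)) :
  (m < r)%N -> exists2 a : 'rV[int]_r, a != 0 & a *m M = 0.
Proof.
move=> mr; set MQ := map_mx intr M : 'M[rat]_(r, m).
have : kermx MQ != 0.
  rewrite -mxrank_eq0 mxrank_ker subn_eq0 -ltnNge.
  exact: leq_ltn_trans (rank_leq_col _) mr.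
move=> /rowV0Pn[u /sub_kermxP uM u0].
pose D := \prod_i denq (u 0 i).
have D0 : D != 0 by apply/prodf_neq0 => i _; exact: denq_neq0.
(* This is [D] times [u], written without division. *)
pose a := \row_i (numq (u 0 i) * \prod_(j | j != i) denq (u 0 j)).
have aE : map_mx intr a = D%:~R *: u.
  apply/rowP => i.
  have -> : D = denq (u 0 i) * \prod_(j | j != i) denq (u 0 j) by rewrite /D (bigD1 i).
  by rewrite !mxE !intrM numqE -[LHS]mulrA [LHS]mulrC.
exists a.
  apply: contraNneq u0 => a0; move: aE; rewrite a0 map_mx0 => /esym/eqP.
  by rewrite scaler_eq0 intr_eq0 (negbTE D0).
have : map_mx intr (a *m M) = 0 :> 'M[rat]_(1, m).
  by rewrite map_mxM aE -scalemxAl uM scaler0.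
move=> /matrixP aM; apply/matrixP => i j; have := aM i j; rewrite !mxE.
by move/eqP; rewrite intr_eq0 => /eqP.
Qed.

(** Extension by zero: it allows families indexed by varying subsets [J] to be handled as families
    on all of [I]. *)
Lemma extend_from_set (I : finType) (J : {set I}) (a : 'I_#|J| -> int) :
  exists a' : I -> int, [/\ forall i, i \notin J -> a' i = 0,
    forall k, a' (enum_val k) = a k &
    forall f : I -> int, \sum_i a' i * f i = \sum_k a k * f (enum_val k)].
Proof.
pose a' i := if [pick k | enum_val k == i] is Some k then a k else 0.
have a'E k : a' (enum_val k) = a k.
  rewrite /a'; case: pickP => [l /eqP/enum_val_inj->//|/(_ k)].
  by rewrite eqxx.
have a'0 i : i \notin J -> a' i = 0.
  move=> iJ; rewrite /a'; case: pickP => [l /eqP li|//].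
  by move: iJ; rewrite -li enum_valP.
exists a'; split => // f; rewrite (bigID (mem J))/= addrC big1 ?add0r.
  by rewrite big_enum_val; apply: eq_bigr => k _; rewrite a'E.
by move=> i /a'0 ->; rewrite mul0r.
Qed.

Lemma int_nontrivial_relation (I : finType) (J : {set I}) (T : eqType)
    (v : I -> T -> int) (s : seq T) : (size s < #|J|)%N ->
  exists a : I -> int, [/\ forall i, i \notin J -> a i = 0,
    exists i, a i != 0 & forall x, x \in s -> \sum_i a i * v i x = 0].
Proof.
move=> sJ.
have [u u0 uM] := int_matrix_left_kernel
  (\matrix_(i < #|J|, j < size s) v (enum_val i) (tnth (in_tuple s) j)) sJ.
have [a [a0 aE asum]] := extend_from_set (fun i => u 0 i).
exists a; split => //.
  have /rV0Pn[i ui] : u != 0 by [].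
  by exists (enum_val i); rewrite aE.
move=> x /(tnthP (in_tuple s))[j ->]; rewrite asum.
have /matrixP/(_ 0 j) := uM; rewrite !mxE; apply: etrans.
by apply: eq_bigr => i _; rewrite !mxE.
Qed.

Section free_subset.
Variables (I : finType) (L : (I -> int) -> Prop).

(** With [L] read as the set of coefficient vectors that become trivial in some quotient, this is
    linear independence in that quotient of the vectors indexed by [J]. *)
Definition rel_free (J : {set I}) : Prop :=
  forall a, L a -> (forall i, i \notin J -> a i = 0) -> forall i, a i = 0.

(** Take [J] maximal. Adding an index [i] destroys freeness, and the relation that results must
    involve [i], since otherwise it would live on [J]. Outside [J] the relations are thus
    diagonal. *)
Lemma max_rel_free : exists2 J : {set I}, rel_free J &
  exists a : I -> I -> int, forall i, i \notin J ->
    [/\ L (a i), a i i != 0 & forall j, j \notin J -> j != i -> a i j = 0].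
Proof.
have free0 : `[< rel_free finset.set0 >].
  by apply/asboolP => a _ a0 i; apply: a0; rewrite inE.
case: (@maxset_exists _ (fun J => `[< rel_free J >]) finset.set0 free0) => J.
move=> /maxsetP[/asboolP Jf Jmax] _; exists J => //.
suff H i : exists b : I -> int, i \notin J ->
    [/\ L b, b i != 0 & forall j, j \notin J -> j != i -> b j = 0].
  by have [a Ha] := choice H; exists a.
case: (boolP (i \in J)) => iJ; first by exists (fun=> 0).
have : ~ rel_free (i |: J).
  move=> /asboolP iJf; move: (iJ).
  by rewrite -(Jmax _ iJf (finset.subsetU1 _ _)) finset.setU11.
move=> /existsNP[b /not_implyP[Lb /not_implyP[b0 /existsNP[k bk]]]].
exists b => _; split => //.
- apply/negP => /eqP bi; apply: bk; apply: Jf => // j jJ.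
  have [->//|ji] := eqVneq j i.
  by apply: b0; rewrite in_setU1 negb_or ji.
- by move=> j jJ ji; apply: b0; rewrite in_setU1 negb_or ji.
Qed.

End free_subset.

Section chains.
Context (R : realType) (d : nat).
Implicit Types (X Y : set (Defs.point R d)) (c z : chain d) (q r : nat).

Lemma chain_bd_sum (I : finType) (a : I -> int) (c : I -> chain d) :
  chain_bd (fun P => \sum_i a i * c i P) = fun P => \sum_i a i * chain_bd (c i) P.
Proof.
apply/funext => P; rewrite /chain_bd.
under [RHS]eq_bigr do rewrite big_distrr/=.
rewrite exchange_big/=; apply: eq_bigr => i _.
rewrite !big_distrl/= -big_split/=; apply: eq_bigr => j _.
by rewrite mulrDr !mulrA.
Qed.

Lemma is_chain_sum X k (I : finType) (a : I -> int) (c : I -> chain d) :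
  (forall i, a i != 0 -> is_chain X k (c i)) ->
  is_chain X k (fun P => \sum_i a i * c i P).
Proof.
move=> cX.
have sum_neq0 P : \sum_i a i * c i P != 0 -> exists2 i, a i != 0 & c i P != 0.
  move=> s0; apply: contrapT => /forall2NP H; move/negP: s0; apply.
  apply/eqP; apply: big1 => i _.
  by have [/negP/negPn/eqP->|/negP/negPn/eqP->] := H i; rewrite ?mul0r ?mulr0.
split.
  apply: (@sub_finite_set _ _ (\bigcup_(i in [set i | a i != 0]) [set Q | c i Q != 0])).
    by move=> P /= /sum_neq0[i ai ci]; exists i.
  by apply: bigcup_finite => // i /= /cX[].
by move=> P /sum_neq0[i /cX[_ H] /H].
Qed.

Lemma sub_is_chain X Y k c : (forall Q, cube_dim Q = k -> c Q != 0 ->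
   @cube_set R _ Q `<=` X -> @cube_set R _ Q `<=` Y) ->
  is_chain X k c -> is_chain Y k c.
Proof.
move=> XY [fc cX]; split=> // Q cQ; have [dQ QX] := cX _ cQ.
by split=> //; exact: XY.
Qed.

Definition bounds X k z : Prop := exists c, is_chain X k.+1 c /\ z = chain_bd c.

Definition is_cycle X k z : Prop := is_chain X k z /\ chain_bd z = (fun=> 0).

Lemma indep_classes_set X q (I : finType) (J : {set I}) (z : I -> chain d) :
  (forall i, i \in J -> is_cycle X q (z i)) ->
  (forall a : I -> int, (forall i, i \notin J -> a i = 0) ->
    bounds X q (fun P => \sum_i a i * z i P) -> forall i, a i = 0) ->
  indep_classes X q #|J|.
Proof.
move=> zX zi; exists (z \o enum_val); split.
  by move=> i; apply: zX; exact: enum_valP.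
move=> a [c [cX ac]] i; have [b [b0 bE bsum]] := extend_from_set a.
rewrite -bE; apply: zi => //; exists c; split => //.
by rewrite -ac; apply/funext => P; rewrite bsum.
Qed.

(** More than [size s] cycles satisfy a nontrivial integer relation already as chains, and the zero
    chain is a boundary. *)
Lemma indep_classes_le X q r (s : seq (cube d)) :
  (forall Q, cube_dim Q = q -> @cube_set R _ Q `<=` X -> Q \in s) ->
  indep_classes X q r -> (r <= size s)%N.
Proof.
move=> sX [z [zX zi]]; rewrite leqNgt; apply/negP => sr.
have [|a [_ [i ai] az]] := @int_nontrivial_relation _ [set: 'I_r] _ z s.
  by rewrite cardsT card_ord.
(* The zero chain is written as an empty sum so that linearity of the boundary applies to it. *)
move/eqP: ai; apply; apply: zi; exists (fun P => \sum_(i < 0) 0 * (fun=> 0) P); split.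
  by apply: is_chain_sum => -[].
rewrite chain_bd_sum; apply/funext => P; rewrite big_ord0.
have [/az//|Ps] := boolP (P \in s).
apply: big1 => j _; have [->|zj] := eqVneq (z j P) 0; first by rewrite mulr0.
by have [[_ /(_ _ zj)[/sX H /H]]] := zX j; rewrite (negbTE Ps).
Qed.

Lemma indep_classes0 X q : indep_classes X q 0.
Proof. by exists (fun=> fun=> 0); split => [[]|? ? []]. Qed.

(** Finitely many available [q]-cubes bound the independent families, so the maximum exists and
    [betti] is not the default value of [xget]. *)
Lemma bettiP X q (s : seq (cube d)) :
  (forall Q, cube_dim Q = q -> @cube_set R _ Q `<=` X -> Q \in s) ->
  indep_classes X q (betti X q) /\
    forall r, indep_classes X q r -> (r <= betti X q)%N.
Proof.
move=> sX; rewrite /betti; case: xgetP => [r _ //|nex].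
have ex0 : exists r, `[< indep_classes X q r >].
  by exists 0%N; apply/asboolP; exact: indep_classes0.
have ub r : `[< indep_classes X q r >] -> (r <= size s)%N.
  by move=> /asboolP; exact: indep_classes_le.
case: (ex_maxnP ex0 ub) => m /asboolP Hm mmax.
by case: (nex m); split => // r Hr; apply: mmax; apply/asboolP.
Qed.

Variables (X Y : set (Defs.point R d)) (q : nat) (s D : seq (cube d)).
Hypothesis XY : X `<=` Y.
Hypothesis sY : forall Q, cube_dim Q = q -> @cube_set R _ Q `<=` Y -> Q \in s.
Hypothesis newD : forall Q, (cube_dim Q = q \/ cube_dim Q = q.+1) ->
  @cube_set R _ Q `<=` Y -> ~ @cube_set R _ Q `<=` X -> Q \in D.

Lemma vanish_is_chain k c : k = q \/ k = q.+1 ->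
  is_chain Y k c -> (forall Q, Q \in D -> c Q = 0) -> is_chain X k c.
Proof.
move=> kq cY cD; apply: sub_is_chain cY => Q Qk cQ QY.
apply: contrapT => QX; move/eqP: cQ; apply; apply: cD; apply: newD => //.
by rewrite Qk.
Qed.

Lemma super_is_chain k c : is_chain X k c -> is_chain Y k c.
Proof. by apply: sub_is_chain => Q _ _ /subset_trans; exact. Qed.

(** Among independent classes of [X], a maximal subfamily [J] free modulo boundaries of [Y] has at
    most [betti Y q] members. Each index outside [J] gives a chain [c i] of [Y] bounding a
    combination of the [z j]. With more than [size D] of these, some combination of the [c i]
    vanishes on [D], hence is a chain of [X], against independence in [X]. *)
Lemma betti_le_super : (betti X q <= betti Y q + size D)%N.
Proof.
have sX Q : cube_dim Q = q -> @cube_set R _ Q `<=` X -> Q \in s.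
  by move=> Qq QX; apply: sY => //; exact: subset_trans XY.
have [[z [zX zi]] _] := bettiP sX.
have [_ maxY] := bettiP sY.
have [J Jf [a Ha]] :=
  max_rel_free (fun a => bounds Y q (fun P => \sum_i a i * z i P)).
have JY : (#|J| <= betti Y q)%N.
  apply: maxY; apply: (indep_classes_set (z := z)).
    by move=> i _; have [cz ?] := zX i; split => //; exact: super_is_chain cz.
  by move=> b b0 bY; apply: Jf.
suff CJ : (#|~: J| <= size D)%N.
  by rewrite -[betti X q]card_ord -(cardsC J) leq_add.
rewrite leqNgt; apply/negP => lt.
have [c Hc] : exists c : 'I_(betti X q) -> chain d, forall i, i \notin J ->
    is_chain Y q.+1 (c i) /\ (fun P => \sum_j a i j * z j P) = chain_bd (c i).
  suff H i : exists ci : chain d, i \notin J -> is_chain Y q.+1 ci /\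
      (fun P => \sum_j a i j * z j P) = chain_bd ci.
    by have [c Hc] := choice H; exists c.
  have [iJ|iJ] := boolP (i \in J); first by exists (fun=> 0).
  by have [[ci ?] _ _] := Ha i iJ; exists ci.
have [b [b0 [i bi] bD]] := int_nontrivial_relation c lt.
have nJ j : b j != 0 -> j \notin J.
  by move=> bj; apply/negP => jJ; move/eqP: bj; apply; apply: b0; rewrite inE jJ.
have : \sum_j b j * a j i = 0.
  apply: (zi (fun k => \sum_j b j * a j k)).
  exists (fun P => \sum_j b j * c j P); split.
    apply: vanish_is_chain => //; first by right.
    by apply: is_chain_sum => j /nJ /Hc[].
  rewrite chain_bd_sum; apply/funext => P.
  under eq_bigr do rewrite big_distrl/=.
  rewrite exchange_big/=; apply: eq_bigr => j _.
  have [->|/nJ /Hc[_ <-]] := eqVneq (b j) 0.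
    by rewrite mul0r big1// => k _; rewrite !mul0r.
  by rewrite big_distrr/=; apply: eq_bigr => k _; rewrite mulrA.
(* As the relations are diagonal outside [J], the coefficient of [z i] is [b i * a i i], a product
   of nonzero integers. *)
rewrite (bigD1 i)//= big1 ?addr0.
  have [_ ai _] := Ha _ (nJ _ bi).
  by move/eqP; rewrite mulf_eq0 (negbTE bi) (negbTE ai).
move=> j ji; have [->|/nJ jJ] := eqVneq (b j) 0; first by rewrite mul0r.
by have [_ _ ->] := Ha _ jJ; rewrite ?mulr0 ?nJ// eq_sym.
Qed.

(** Here the relations are the combinations of cycles of [Y] that vanish on [D]. A free set has at
    most [size D] elements; each index outside it gives a cycle lying in [X], and these stay
    independent because a boundary in [X] is one in [Y]. *)
Lemma betti_super_le : (betti Y q <= betti X q + size D)%N.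
Proof.
have sX Q : cube_dim Q = q -> @cube_set R _ Q `<=` X -> Q \in s.
  by move=> Qq QX; apply: sY => //; exact: subset_trans XY.
have [[z [zY zi]] _] := bettiP sY.
have [_ maxX] := bettiP sX.
have [J Jf [a Ha]] :=
  max_rel_free (fun a => forall P, P \in D -> \sum_i a i * z i P = 0).
have JD : (#|J| <= size D)%N.
  rewrite leqNgt; apply/negP => lt.
  have [b [b0 [i bi] bD]] := int_nontrivial_relation z lt.
  by move/eqP: bi; apply; apply: Jf.
suff CJ : (#|~: J| <= betti X q)%N.
  by rewrite -[betti Y q]card_ord -(cardsC J) addnC leq_add.
apply: maxX; apply: (indep_classes_set (z := fun i P => \sum_j a i j * z j P)).
  move=> i; rewrite inE => /Ha[aD ai _]; split.
    apply: vanish_is_chain => //; first by left.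
    by apply: is_chain_sum => j _; case: (zY j) => -[].
  rewrite chain_bd_sum; apply/funext => P; apply: big1 => j _.
  by have [_ ->] := zY j; rewrite mulr0.
move=> b b0 [c [cX bc]] i.
apply/eqP; apply: contraT => bi.
have nJ j : b j != 0 -> j \notin J.
  by move=> bj; apply/negP => jJ; move/eqP: bj; apply; apply: b0; rewrite inE jJ.
have : \sum_j b j * a j i = 0.
  apply: (zi (fun k => \sum_j b j * a j k)).
  exists c; split; first exact: super_is_chain.
  rewrite -bc; apply/funext => P.
  under eq_bigr do rewrite big_distrl/=.
  rewrite exchange_big/=; apply: eq_bigr => j _.
  by rewrite big_distrr/=; apply: eq_bigr => k _; rewrite mulrA.
rewrite (bigD1 i)//= big1 ?addr0.
  have [_ ai _] := Ha _ (nJ _ bi).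
  by move/eqP; rewrite mulf_eq0 (negbTE bi) (negbTE ai).
move=> j ji; have [->|/nJ jJ] := eqVneq (b j) 0; first by rewrite mul0r.
by have [_ _ ->] := Ha _ jJ; rewrite ?mulr0 ?nJ// eq_sym.
Qed.

End chains.

(** * Vitali covering in the lattice *)

Section lattice.
Variable d : nat.
Local Notation Zd := {ffun 'I_d -> int}.
Implicit Types (x y z : Zd) (n r : nat) (U : seq Zd).

Definition nearby x n y : bool := [forall i, (`|x i - y i| <= n)%N].

Definition grid n : seq Zd :=
  [seq [ffun i => (u i)%:Z - n%:Z] | u : {ffun 'I_d -> 'I_(n.*2.+1)}].

Definition ball_seq x n : seq Zd := [seq x + y | y <- grid n].

Lemma mem_grid n y : (y \in grid n) = [forall i, (`|y i| <= n)%N].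
Proof.
apply/mapP/forallP => [[u _ ->] i|yn].
  by rewrite ffunE; case: (u i) => m /=; lia.
exists [ffun i => inord `|y i + n%:Z|]; first by rewrite mem_enum.
by apply/ffunP => i; rewrite !ffunE; have := yn i; set v := y i => vn; rewrite inordK; lia.
Qed.

Lemma mem_ball_seq x n y : (y \in ball_seq x n) = nearby x n y.
Proof.
apply/mapP/forallP => [[z + ->] i|xy].
  by rewrite mem_grid => /forallP/(_ i); rewrite !ffunE; move: (x i) (z i) => a b; lia.
exists (y - x); last by rewrite addrC subrK.
by rewrite mem_grid; apply/forallP => i; have := xy i; rewrite !ffunE; move: (x i) (y i) => a b; lia.
Qed.

Lemma uniq_grid n : uniq (grid n).
Proof.
rewrite map_inj_uniq ?enum_uniq// => u v /ffunP uv; apply/ffunP => i.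
by apply: val_inj; have := uv i; rewrite !ffunE; case: (u i) (v i) => a ? [b ?] /=; lia.
Qed.

Lemma uniq_ball_seq x n : uniq (ball_seq x n).
Proof. by rewrite map_inj_uniq ?uniq_grid//; exact: addrI. Qed.

Lemma size_grid n : size (grid n) = (n.*2.+1 ^ d)%N.
Proof. by rewrite size_map -cardE card_ffun !card_ord. Qed.

Lemma size_ball_seq x n : size (ball_seq x n) = (n.*2.+1 ^ d)%N.
Proof. by rewrite size_map size_grid. Qed.

(* Greedy Vitali selection: the largest ball absorbs every centre within twice
   its radius, and its mass is disjoint from that of the remaining balls. *)
Lemma vitali_count (R : realType) U (f : Zd -> nat) (S : seq Zd) (rad : Zd -> nat)
    (lam : R) :
  0 <= lam -> uniq S ->
  (forall x, x \in S ->
    lam * ((rad x).*2.+1 ^ d)%:R <= (\sum_(y <- U | nearby x (rad x) y) f y)%:R) ->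
  lam * (size S)%:R <= 2 ^+ d * (\sum_(y <- U) f y)%:R.
Proof.
move=> lam0; have [k] := ubnP (size S); elim: k => // k IH in S f *.
move=> Sk uS Hf; case: (posnP (size S)) => [->|S0].
  by rewrite mulr0 mulr_ge0// exprn_ge0.
have [x xS xmax] : exists2 x, x \in S & forall y, y \in S -> (rad y <= rad x)%N.
  have [x0 x0S] : exists x0, x0 \in S by case: S S0 {Sk uS Hf} => // a S _; exists a; rewrite mem_head.
  pose F (u : seq_sub S) := rad (val u).
  case: (@arg_maxnP _ (SeqSub x0S) xpredT F isT) => u _ umax.
  by exists (val u); [exact: valP|move=> y yS; exact: (umax (SeqSub yS))].
set S1 := [seq y <- S | nearby x (rad x).*2 y].
set S2 := [seq y <- S | ~~ nearby x (rad x).*2 y].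
have SE : size S = (size S1 + size S2)%N by rewrite !size_filter count_predC.
(* The ball of doubled radius has side [4r+1], at most twice [2r+1]; this is the source of the
   factor [2 ^+ d]. *)
have S1x : (size S1 <= 2 ^ d * (rad x).*2.+1 ^ d)%N.
  rewrite -expnMn; apply: (@leq_trans ((rad x).*2.*2.+1 ^ d)); last first.
    by case: d => // d'; rewrite leq_exp2r//; lia.
  rewrite -(size_ball_seq x); apply: uniq_leq_size; first exact: filter_uniq.
  by move=> y; rewrite mem_filter mem_ball_seq => /andP[].
have xx : nearby x (rad x).*2 x by apply/forallP => i; lia.
have S2k : (size S2 < k)%N.
  rewrite -ltnS; apply: leq_trans Sk; rewrite ltnS SE -[X in (X < _)%N]add0n ltn_add2r.
  by rewrite size_filter -has_count; apply/hasP; exists x.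
pose f' y := if nearby x (rad x) y then 0%N else f y.
have := IH S2 f' S2k (filter_uniq _ uS).
have -> : (\sum_(y <- U) f y =
    \sum_(y <- U | nearby x (rad x) y) f y + \sum_(y <- U) f' y)%N.
  rewrite (bigID (nearby x (rad x)))/=; congr (_ + _)%N.
  by rewrite big_mkcond/=; apply: eq_bigr => y _; rewrite /f'; case: nearby.
(* A remaining centre is farther than [2 * rad x] from [x] and has radius at most [rad x], so its
   ball misses that of [x] and loses no mass in [f']. *)
move=> /(_ _)/wrap[z|{}IH].
  rewrite mem_filter => /andP[zx zS]; rewrite (le_trans (Hf _ zS))// ler_nat.
  apply: leq_sum => y zy; rewrite /f'; case: ifP => // xy; exfalso.
  move/negP: zx; apply; apply/forallP => i.
  have := forallP zy i; have := forallP xy i; have := xmax _ zS.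
  by move: (x i) (y i) (z i) => a b c; lia.
rewrite SE !natrD !mulrDr lerD//.
apply: (@le_trans _ _ (2 ^+ d * (lam * ((rad x).*2.+1 ^ d)%:R))).
  by rewrite mulrCA ler_wpM2l// -natrX -natrM ler_nat.
by rewrite ler_wpM2l ?exprn_ge0// Hf.
Qed.

End lattice.

(** * Variation of the Betti curve *)

Section cubes.
Context (R : realType) (d : nat).
Local Notation Zd := {ffun 'I_d -> int}.
Implicit Types (Q : cube d) (x y : Zd) (w : Omega R d) (s t : R) (n : nat).

Definition mkcube x (b : {ffun 'I_d -> bool}) : cube d := [ffun i => (x i, b i)].

Definition base Q : Zd := [ffun i => (Q i).1].

Lemma mkcubeE Q : mkcube (base Q) [ffun i => (Q i).2] = Q.
Proof. by apply/ffunP => i; rewrite !ffunE -surjective_pairing. Qed.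

Definition cube_box n : seq (cube d) :=
  [seq mkcube y b | y <- grid d n, b <- enum {: {ffun 'I_d -> bool}}].

Lemma mem_cube_box n Q : (forall i, (`|(Q i).1| <= n)%N) -> Q \in cube_box n.
Proof.
move=> Qn; rewrite -(mkcubeE Q); apply/allpairsP; exists (base Q, [ffun i => (Q i).2]).
split => //=; last by rewrite mem_enum.
by rewrite mem_grid; apply/forallP => i; rewrite ffunE.
Qed.

Definition activations w s t y : nat :=
  \sum_(b : {ffun 'I_d -> bool}) (s < w (mkcube y b) <= t)%R.

Lemma le_activations w s t u y : t <= u ->
  (activations w s t y <= activations w s u y)%N.
Proof.
move=> tu; apply: leq_sum => b _; case: (s < _) => //=.
by case: (leP _ t) => // /le_trans ->.
Qed.

(** The inclusion of [Q] in [Q'] in coordinates: a degenerate factor [[l]] may lie in [[l]],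
    [[l,l+1]] or [[l-1,l]]. *)
Definition coface Q Q' : Prop := forall i,
  if (Q i).2 then Q' i = Q i
  else ((Q' i).1 == (Q i).1) || (Q' i == ((Q i).1 - 1, true)).

Lemma coface_sub Q Q' : coface Q Q' -> @cube_set R _ Q `<=` cube_set Q'.
Proof.
move=> QQ' x Qx i; have := QQ' i; have := Qx i.
case: (Q i) => l [] /=; first by move=> xl ->.
move=> /eqP -> /orP[/eqP ->|/eqP -> /=]; last by rewrite subrK !ler_int; lia.
by case: ifP => // _; rewrite !ler_int; lia.
Qed.

Definition center Q : Defs.point R d :=
  fun i => (Q i).1%:~R + if (Q i).2 then 2^-1 else 0.

Lemma center_mem Q : cube_set Q (center Q).
Proof.
move=> i; rewrite /center; case: (Q i) => l [] /=; last by rewrite addr0.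
by rewrite intrD; lra.
Qed.

Lemma center_coface Q Q' : cube_set Q' (center Q) -> coface Q Q'.
Proof.
have step (a b : int) : a < b -> a%:~R + 1 <= b%:~R :> R.
  by rewrite -lezD1 -(ler_int R) intrD.
move=> QQ' i; have := QQ' i; rewrite /center.
case: (Q i) (Q' i) => l [] [l' []] /=.
- rewrite intrD => /andP[h1 h2]; have [/step h|/step h|->//] := ltgtP l l'; exfalso; lra.
- by move=> /eqP h; have [/step ?|/step ?|l_l] := ltgtP l l'; exfalso; [lra|lra|subst; lra].
- rewrite addr0 !ler_int => /andP[h1 h2]; rewrite xpair_eqE andbT; lia.
- by rewrite addr0 => /eqP/intr_inj ->; rewrite eqxx.
Qed.

(** The centre of [Q] is in its relative interior, so a cube containing the centre contains all of
    [Q]; a cube covered by the union therefore lies in a single member. *)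
Lemma cube_sub_Xt w t Q :
  @cube_set R _ Q `<=` Xt w t <-> exists2 Q', coface Q Q' & w Q' <= t.
Proof.
split; first by move=> /(_ _ (center_mem Q))[Q' wQ' /center_coface]; exists Q'.
by move=> [Q' /coface_sub QQ' wQ'] x /QQ'; exists Q'.
Qed.

Lemma cube_sub_Lambda n Q : @cube_set R _ Q `<=` Lambda n ->
  forall i, (`|(Q i).1| <= n)%N.
Proof.
move=> /(_ (fun i => (Q i).1%:~R))H i.
suff /H/(_ i) : @cube_set R _ Q (fun i => (Q i).1%:~R).
  by rewrite !pmulrn -mulrNz !ler_int; lia.
by move=> j; case: (Q j) => l [] /=; rewrite ?eqxx// !ler_int; lia.
Qed.

Lemma beta_n_variation q w n s t : s <= t ->
  `| (beta_n q w n t)%:R - (beta_n q w n s)%:R | <=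
    (4 ^ d * \sum_(y <- grid d n.+1) activations w s t y)%:R :> R.
Proof.
move=> st.
(* A coface of a cube in [Lambda n] may stick out by one unit, hence [n.+1]. In [face], each factor
   has four choices (corner shifted or not, degenerate or not), which covers all faces and gives
   [4 ^ d]. *)
pose hit := [seq Q <- cube_box n.+1 | s < w Q <= t].
pose face Q (u : {ffun 'I_d -> bool * bool}) : cube d :=
  [ffun i => ((Q i).1 + (u i).1%:Z, (u i).2)].
pose D := [seq face Q u | Q <- hit, u <- enum {: {ffun 'I_d -> bool * bool}}].
have sizeD : size D = (4 ^ d * \sum_(y <- grid d n.+1) activations w s t y)%N.
  rewrite size_allpairs -cardE card_ffun card_prod card_bool card_ord mulnC.
  rewrite size_filter -sum1_count big_mkcond/= big_allpairs_dep/=; congr (_ * _)%N.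
  apply: eq_bigr => y _; rewrite /activations big_enum/=; apply: eq_bigr => b _.
  by case: ifP.
have XY : Xt w s `&` @Lambda R d n `<=` Xt w t `&` @Lambda R d n.
  by move=> x [[Q /= ws xQ] xn]; split => //; exists Q => //=; exact: le_trans st.
have inY Q : @cube_set R _ Q `<=` Xt w t `&` @Lambda R d n -> Q \in cube_box n.
  by rewrite subsetI => -[_ /cube_sub_Lambda/mem_cube_box].
have newD Q : @cube_set R _ Q `<=` Xt w t `&` @Lambda R d n ->
    ~ @cube_set R _ Q `<=` Xt w s `&` @Lambda R d n -> Q \in D.
  rewrite [X in X -> _]subsetI => -[/cube_sub_Xt[Q' QQ' wt] Qn] nQ.
  have ws : s < w Q'.
    rewrite ltNge; apply/negP => ws; apply: nQ; rewrite subsetI; split => //.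
    by apply/cube_sub_Xt; exists Q'.
  apply/allpairsP; exists (Q', [ffun i => ((Q' i).1 != (Q i).1, (Q i).2)]).
  split => /=; [|by rewrite mem_enum|].
    rewrite mem_filter ws wt; apply: mem_cube_box => i.
    have := cube_sub_Lambda Qn i; have := QQ' i.
    by case: (Q i) (Q' i) => l [] [l' b] /=; rewrite ?xpair_eqE; case; lia.
  apply/ffunP => i; rewrite !ffunE; have := QQ' i.
  case: (Q i) (Q' i) => l [] [l' b] /=; rewrite ?xpair_eqE.
    by case=> -> _; rewrite eqxx addr0.
  by have [->|/= _ /andP[/eqP-> _]] := eqVneq l' l; rewrite ?addr0 ?subrK.
rewrite -sizeD /beta_n ler_norml lerBlDr lerNl opprB lerBlDr.
have h1 := betti_super_le XY (fun Q _ => inY Q) (fun Q _ => newD Q).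
have h2 := betti_le_super XY (fun Q _ => inY Q) (fun Q _ => newD Q).
by rewrite -!natrD !ler_nat !(addnC (size D)) h1 h2.
Qed.

End cubes.

(** * Maximal inequality and ergodicity *)

Lemma sum_indic_measure_le (dd : measure_display) (T : measurableType dd) (R : realType)
    (P : probability T R) (I J : Type) (u : seq I) (v : seq J)
    (A : I -> set T) (B : J -> set T) (a b : R) :
  0 <= a -> 0 <= b ->
  (forall i, measurable (A i)) -> (forall j, measurable (B j)) ->
  (forall w, a * \sum_(i <- u) \1_(A i) w <= b * \sum_(j <- v) \1_(B j) w) ->
  (a%:E * \sum_(i <- u) P (A i) <= b%:E * \sum_(j <- v) P (B j))%E.
Proof.
move=> a0 b0 mA mB le_ab.
have intE (K : Type) (l : seq K) (D : K -> set T) (c : R) :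
    0 <= c -> (forall k, measurable (D k)) ->
    (\int[P]_w (c * \sum_(k <- l) \1_(D k) w)%:E = c%:E * \sum_(k <- l) P (D k))%E.
  move=> c0 mD; under eq_integral do rewrite EFinM -sumEFin.
  have mI k : measurable_fun setT (EFin \o (\1_(D k) : T -> R)).
    by apply/measurable_EFinP; exact: measurable_indic.
  rewrite ge0_integralZl_EFin//.
  - rewrite ge0_integral_sum//.
    by congr (_ * _)%E; apply: eq_bigr => k _; rewrite integral_indic// setIT.
  - by move=> w _; apply: sume_ge0.
  - exact: emeasurable_sum.
rewrite -!intE//; apply: ge0_le_integral => //.
- by move=> w _; rewrite lee_fin mulr_ge0//; apply: sumr_ge0 => k _.
- apply/measurable_EFinP; apply: measurable_funM => //.
  by apply: measurable_sum => k; exact: measurable_indic.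
- apply/measurable_EFinP; apply: measurable_funM => //.
  by apply: measurable_sum => k; exact: measurable_indic.
- by move=> w _; rewrite lee_fin.
Qed.

Section maximal.
Context (R : realType) (d : nat) (P : probability (Omega R d) R) (s t : R).
Local Notation Zd := {ffun 'I_d -> int}.
Implicit Types (Q : cube d) (x y : Zd) (w : Omega R d) (lam : R) (n N : nat).

Definition hits w x n : nat := \sum_(y <- ball_seq x n) activations w s t y.

Definition active Q : set (Omega R d) := [set w | s < w Q <= t].

Lemma measurable_active Q : measurable (active Q).
Proof.
apply: sub_sigma_algebra; exists Q => //; exists [set` `]s, t]] => //=.
Qed.

Lemma activationsE w y :
  (activations w s t y)%:R = \sum_b \1_(active (mkcube y b)) w :> R.
Proof.
rewrite natr_sum; apply: eq_bigr => b _; rewrite indicE; congr (_%:R).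
by case: (boolP (_ < _ <= _)) => h; [rewrite mem_set|rewrite memNset//; exact/negP].
Qed.

Lemma measurable_hits x n : measurable_fun setT (fun w => (hits w x n)%:R : R).
Proof.
rewrite (_ : (fun _ => _) = fun w =>
  \sum_(y <- ball_seq x n) \sum_b \1_(active (mkcube y b)) w).
  apply: measurable_sum => y; apply: measurable_sum => b.
  by apply: measurable_indic; exact: measurable_active.
by apply/funext => w; rewrite natr_sum; apply: eq_bigr => y _; exact: activationsE.
Qed.

Definition exceeds lam x n : set (Omega R d) :=
  [set w | lam * (n.*2.+1 ^ d)%:R < (hits w x n)%:R].

Lemma measurable_exceeds lam x n : measurable (exceeds lam x n).
Proof.
have := measurable_hits x n measurableT
  (measurable_itv `]lam * (n.*2.+1 ^ d)%:R, +oo[).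
rewrite setTI; congr measurable.
by apply/seteqP; split => w; rewrite /= in_itv/= andbT.
Qed.

Lemma hits_tau x y n w : hits (tau x w) y n = hits w (y - x) n.
Proof.
have mkE z (b : {ffun 'I_d -> bool}) :
    cube_shift [ffun i => - x i] (mkcube z b) = mkcube (z - x) b.
  by apply/ffunP => i; rewrite !ffunE.
rewrite /hits !big_map; apply: eq_bigr => z _.
by apply: eq_bigr => b _; rewrite /tau mkE addrAC.
Qed.

Lemma exceeds_tau lam x y n :
  tau x @^-1` exceeds lam y n = exceeds lam (y - x) n.
Proof. by apply/seteqP; split => w; rewrite /exceeds/= hits_tau. Qed.

Definition exceeds_upto lam x N : set (Omega R d) :=
  \bigcup_(n in `I_N.+1) exceeds lam x n.

Lemma measurable_exceeds_upto lam x N : measurable (exceeds_upto lam x N).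
Proof. by apply: bigcup_measurable => n _; exact: measurable_exceeds. Qed.

Hypothesis Pstat : stationary P.

Lemma exceeds_upto_stationary lam x N :
  P (exceeds_upto lam x N) = P (exceeds_upto lam 0 N).
Proof.
rewrite -(Pstat (- x) (measurable_exceeds_upto lam 0 N)); congr (P _).
rewrite preimage_bigcup; apply: eq_bigcupr => n _.
by rewrite exceeds_tau sub0r opprK.
Qed.

(** Transference: for a fixed configuration the covering bound is applied to the bad centres in the
    box of radius [N]. Their radii are at most [N], so every ball stays in the box of radius
    [2N]. *)
Lemma exceeds_upto_count lam N w : 0 <= lam ->
  lam * \sum_(x <- grid d N) \1_(exceeds_upto lam x N) w <=
  2 ^+ d * \sum_(yb <- [seq (y, b) | y <- grid d N.*2, b <- enum {: {ffun 'I_d -> bool}}])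
              \1_(active (mkcube yb.1 yb.2)) w.
Proof.
move=> lam0.
have [rad Hrad] : exists rad : Zd -> nat, forall x, exceeds_upto lam x N w ->
    (rad x <= N)%N /\ exceeds lam x (rad x) w.
  suff H x : exists r, exceeds_upto lam x N w -> (r <= N)%N /\ exceeds lam x r w.
    by have [rad H'] := choice H; exists rad.
  have [[r /= rN er]|h] := pselect (exceeds_upto lam x N w); last by exists 0%N.
  by exists r.
pose S := [seq x <- grid d N | w \in exceeds_upto lam x N].
have -> : \sum_(x <- grid d N) \1_(exceeds_upto lam x N) w = (size S)%:R :> R.
  rewrite size_filter -sum1_count natr_sum [RHS]big_mkcond/=.
  by apply: eq_bigr => x _; rewrite indicE; case: (_ \in _).
have -> : \sum_(yb <- [seq (y, b) | y <- grid d N.*2, b <- enum {: {ffun 'I_d -> bool}}])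
     \1_(active (mkcube yb.1 yb.2)) w =
    (\sum_(y <- grid d N.*2) activations w s t y)%:R :> R.
  rewrite big_allpairs_dep natr_sum; apply: eq_bigr => y _.
  by rewrite activationsE big_enum.
apply: (vitali_count (rad := rad)) => //; first by rewrite filter_uniq ?uniq_grid.
move=> x; rewrite mem_filter mem_grid => /andP[/set_mem/Hrad[rN er] /forallP xN].
rewrite (le_trans (ltW er))// ler_nat /hits -[leqRHS]big_filter.
rewrite (perm_big [seq y <- grid d N.*2 | nearby x (rad x) y])//.
apply: uniq_perm (uniq_ball_seq _ _) (filter_uniq _ (uniq_grid _ _)) _.
move=> y; rewrite mem_ball_seq mem_filter; case: (boolP (nearby _ _ _)) => //= /forallP xy.
rewrite mem_grid; apply/esym/forallP => i; have := xy i; have := xN i.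
by move: (x i) (y i) => a b; lia.
Qed.

Variable p : R.
Hypothesis Pp : forall Q, (P (active Q) <= p%:E)%E.

Lemma p_ge0 : 0 <= p.
Proof. by rewrite -lee_fin (le_trans _ (Pp [ffun => (0, true)])). Qed.

(** Integrating the counting bound, stationarity turns the left side into [(2N+1)^d] equal terms.
    The right side has [(4N+1)^d * 2^d] cubes, each active with probability at most [p]; with the
    covering factor [2^d] and [4N+1 <= 2(2N+1)] the constant is [8^d]. *)
Lemma exceeds_upto_prob lam N : 0 <= lam ->
  (lam%:E * P (exceeds_upto lam 0%R N) <= (8 ^+ d * p)%:E)%E.
Proof.
move=> lam0.
have := sum_indic_measure_le P lam0 (exprn_ge0 d (ler0n R 2))
  (fun x => measurable_exceeds_upto lam x N)
  (fun yb => measurable_active (mkcube yb.1 yb.2))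
  (fun w => exceeds_upto_count N w lam0).
under eq_bigr do rewrite exceeds_upto_stationary.
set v := (X in (_ <= _ * \sum_(j <- X) _)%E).
have sv : size v = ((N.*2.*2.+1) ^ d * 2 ^ d)%N.
  by rewrite size_allpairs size_grid -cardE card_ffun card_bool card_ord.
have Pfin : P (exceeds_upto lam 0 N) \is a fin_num.
  by apply: fin_num_measure; exact: measurable_exceeds_upto.
have -> : (\sum_(i <- grid d N) P (exceeds_upto lam 0%R N) =
   (N.*2.+1 ^ d)%:R%:E * P (exceeds_upto lam 0%R N))%E.
  by rewrite -(fineK Pfin) sumEFin big_const_seq count_predT size_grid iter_addr_0 -EFinM mulr_natl.
have hv : (\sum_(yb <- v) P (active (mkcube yb.1 yb.2)) <= (p *+ size v)%:E)%E.
  apply: (@le_trans _ _ (\sum_(yb <- v) p%:E)%E); first by apply: lee_sum.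
  by rewrite sumEFin big_const_seq count_predT iter_addr_0.
have d2 : (0 <= (2 ^+ d)%:E :> \bar R)%E by rewrite lee_fin exprn_ge0.
move=> h; have {}h := le_trans h (lee_wpmul2l d2 hv).
move: h; rewrite -(fineK Pfin) -!EFinM !lee_fin; set PE := fine _ => h.
have V0 : 0 < (N.*2.+1 ^ d)%:R :> R by rewrite ltr0n expn_gt0.
rewrite -(ler_pM2r V0) -mulrA (mulrC PE) (le_trans h)// sv.
have nat_le : (2 ^ d * (N.*2.*2.+1 ^ d * 2 ^ d) <= 8 ^ d * N.*2.+1 ^ d)%N.
  by rewrite -!expnMn; case: d => // d'; rewrite leq_exp2r//; lia.
move: nat_le; rewrite -(ler_nat R) !natrM !natrX => nat_le.
rewrite -[p *+ _]mulr_natr natrM !natrX mulrCA [leRHS]mulrAC [leRHS]mulrC.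
by rewrite ler_wpM2l ?p_ge0// -natrX.
Qed.

Lemma exceeds_ever_prob lam : 0 < lam ->
  (P (\bigcup_n exceeds lam 0%R n) <= (8 ^+ d * p / lam)%:E)%E.
Proof.
move=> lam0.
have -> : \bigcup_n exceeds lam 0 n = \bigcup_N exceeds_upto lam 0 N.
  apply/seteqP; split => w [n _ h]; first by exists n => //; exists n => //=.
  by case: h => m _ ?; exists m.
have cv : P (exceeds_upto lam 0 N) @[N --> \oo] --> P (\bigcup_N exceeds_upto lam 0 N).
  apply: nondecreasing_cvg_mu => [n||n m nm].
  - exact: measurable_exceeds_upto.
  - by apply: bigcupT_measurable => n; exact: measurable_exceeds_upto.
  - rewrite subsetEset => w [k /= kn h]; exists k => //=.
    by move: kn nm; rewrite !ltnS; exact: leq_trans.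
rewrite -(cvg_lim _ cv)//; apply: lime_le; first by apply/cvg_ex; eexists; exact: cv.
apply: nearW => N; rewrite EFinM lee_pdivlMr// muleC.
exact: exceeds_upto_prob (ltW lam0).
Qed.

Hypothesis Perg : ergodic P.

Definition often lam x : set (Omega R d) :=
  \bigcap_N \bigcup_(n in [set n | (N <= n)%N]) exceeds lam x n.

Lemma measurable_often lam x : measurable (often lam x).
Proof.
apply: bigcapT_measurable => N; apply: bigcup_measurable => n _.
exact: measurable_exceeds.
Qed.

(** The ball of radius [n] about [x] lies in the ball of radius [n + r] about the origin, where [r]
    bounds the coordinates of [x]. For [n >= r] the volume grows by at most [2 ^ d], which the
    higher threshold absorbs. *)
Lemma often_sub_ever lam x : 0 <= lam ->
  often (2 ^+ d * lam) x `<=` \bigcup_n exceeds lam 0 n.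
Proof.
move=> lam0 w wx; pose r := (\sum_i `|x i|)%N.
have xr i : (`|x i| <= r)%N by rewrite /r (bigD1 i)//= leq_addr.
have [n /= rn h] := wx r I; exists (n + r)%N => //; rewrite /exceeds/=.
apply: (@le_lt_trans _ _ (2 ^+ d * lam * (n.*2.+1 ^ d)%:R)).
  rewrite [leRHS]mulrAC [leRHS]mulrC ler_wpM2l//.
  rewrite -natrX -natrM ler_nat -expnMn.
  by case: d => // d'; rewrite leq_exp2r//; lia.
apply: (lt_le_trans h); rewrite ler_nat /hits.
apply: (uniq_sub_le_big (le := leq)) => //; first by move=> a b; exact: leq_addr.
- exact: uniq_ball_seq.
- exact: uniq_ball_seq.
move=> y; rewrite !mem_ball_seq => /forallP xy; apply/forallP => i.
have := xy i; have := xr i; rewrite ffunE; move: (x i) (y i) => a b; lia.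
Qed.

(** The union of [often] over all centres is exactly invariant, so its probability is 0 or 1. It is
    contained in the event of the maximal inequality, of probability at most [8 ^+ d * p / lam < 1],
    so it is null. *)
Lemma ae_hits_le lam : 8 ^+ d * p < lam ->
  {ae P, forall w, \forall n \near \oo,
     (\sum_(y <- grid d n) activations w s t y)%:R <=
       2 ^+ d * lam * (n.*2.+1 ^ d)%:R}.
Proof.
move=> plam.
have lam0 : 0 < lam by apply: le_lt_trans plam; rewrite mulr_ge0// ?exprn_ge0// p_ge0.
pose A := \bigcup_x often (2 ^+ d * lam) x.
have mA : measurable A.
  apply: countable_bigcupT_measurable => [|x]; first exact: countableP.
  exact: measurable_often.
have A0 : P A = 0%E.
  have Ainv x : tau x @^-1` A = A.
    rewrite /A preimage_bigcup; apply/seteqP; split => w [y _ h].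
      exists (y - x) => // N _; have [n Nn hn] := h N I; exists n => //.
      by rewrite -exceeds_tau.
    exists (y + x) => // N _; have [n Nn hn] := h N I; exists n => //.
    suff: (tau x @^-1` exceeds (2 ^+ d * lam) (y + x) n) w by [].
    by rewrite exceeds_tau addrK.
  have [//|A1] := Perg mA Ainv.
  have : (P A <= (8 ^+ d * p / lam)%:E)%E.
    apply: le_trans (exceeds_ever_prob lam0).
    apply: le_measure; rewrite ?inE//.
      by apply: bigcupT_measurable => n; exact: measurable_exceeds.
    by move=> w [x _]; apply: often_sub_ever; exact: ltW.
  by rewrite A1 lee_fin ler_pdivlMr// mul1r leNgt plam.
exists A; split => // w /= nw; exists 0 => // N _; apply: contrapT => nN; apply: nw.
exists N => // n /= Nn; rewrite leNgt; apply/negP => h; apply: nN; exists n => //.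
rewrite /exceeds/= /hits big_map.
by under eq_bigr do rewrite add0r.
Qed.

End maximal.

(** * Uniform convergence *)

Lemma within_itv_unif_continuous (R : realType) (f : R -> R) (a b e : R) :
  {within `[a, b], continuous f} -> 0 < e ->
  \forall m \near \oo, forall x, x \in `[a, b] -> forall y, y \in `[a, b] ->
    `|x - y| <= m.+1%:R^-1 -> `|f x - f y| <= e.
Proof.
move=> /subspace_continuousP fc e0.
have [cov _] := compact_near_coveringP (`[a, b] : set R).
have /cov {}cov : compact (`[a, b] : set R) by exact: segment_compact.
(* Compactness in covering form: if [good m x'] holds for [x'] near each point and [m] large, one
   [m] serves the whole segment. *)
pose good (m : nat) (x : R) := forall y, y \in `[a, b] -> x \in `[a, b] ->
  `|x - y| <= m.+1%:R^-1 -> `|f x - f y| <= e.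
suff : \forall m \near \oo, `[a, b] `<=` good m.
  apply: filterS => m Hm x xab y yab; apply: Hm => //.
apply: cov => x xab.
have e2 : 0 < e / 2 by lra.
have /cvgrPdist_lt/(_ _ e2) := fc _ xab.
rewrite near_withinE => /nbhs_ballP[r /= r0 Hr].
have r2 : 0 < r / 2 by lra.
have Hx y : y \in `[a, b] -> `|x - y| < r -> `|f x - f y| < e / 2.
  by move=> yab xy; exact: Hr.
near=> x' m => y yab x'ab x'y.
have xx' : `|x - x'| < r / 2 by near: x'; exact: nbhsx_ballx.
have mr : m.+1%:R^-1 < r / 2 by near: m; exact: near_infty_natSinv_lt (PosNum r2).
have h1 : `|f x - f x'| < e / 2 by apply: Hx => //; lra.
have h2 : `|f x - f y| < e / 2.
  apply: Hx => //; rewrite -(subrKA x') (le_lt_trans (ler_normD _ _))//.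
  by rewrite [ltRHS](splitr r) ltrD// (le_lt_trans x'y).
rewrite -(subrKA (f x)) (le_trans (ler_normD _ _))// distrC.
by rewrite [leRHS](splitr e) lerD// ltW.
Unshelve. all: by end_near.
Qed.

Lemma unit_itv_cell (R : realType) (m : nat) (t : R) : t \in `[0, 1] ->
  exists2 k : 'I_m.+1, k%:R / m.+1%:R <= t & t <= k.+1%:R / m.+1%:R.
Proof.
rewrite in_itv/= => /andP[t0 t1].
have m0 : 0 < m.+1%:R :> R by rewrite ltr0n.
(* At [t = 1] the truncation would give the index [m.+1], out of range; this point goes to the last
   cell. *)
have [->|tn1] := eqVneq t 1.
  by exists ord_max => /=; rewrite ?divff ?gt_eqF// ler_pdivrMr// mul1r ler_nat.
have tm0 : 0 <= t * m.+1%:R by rewrite mulr_ge0// ltW.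
have /andP[h1 h2] := truncn_itv tm0.
have km : (Num.truncn (t * m.+1%:R) < m.+1)%N.
  rewrite -(ltr_nat R) (le_lt_trans h1)// -[ltRHS]mul1r ltr_pM2r//.
  by rewrite lt_neqAle tn1.
by exists (Ordinal km); rewrite /= ?ler_pdivrMr// ler_pdivlMr// ltW.
Qed.

Section uniform.
Context (R : realType) (d : nat) (P : probability (Omega R d) R).
Hypotheses (Pstat : stationary P) (Perg : ergodic P).
Hypothesis cdf_cont :
  forall Q : cube d, {within `[0, 1], continuous (marginal_cdf P Q)}.

(** By stationarity only the [2^d] types of cubes at the origin matter, so a single mesh can serve
    all cubes. *)
Lemma marginal_cdf_base (Q : cube d) :
  marginal_cdf P Q = marginal_cdf P (mkcube 0 [ffun i => (Q i).2]).
Proof.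
apply/funext => t; rewrite /marginal_cdf; congr fine.
set Q0 := mkcube _ _.
have mQ0 : measurable [set w : Omega R d | w Q0 <= t].
  apply: sub_sigma_algebra; exists Q0 => //; exists [set` `]-oo, t]] => //=.
rewrite -(Pstat (- base Q) mQ0); congr (P _); apply/seteqP.
suff shQ : cube_shift [ffun i => - (- base Q) i] Q0 = Q.
  by split => w; rewrite /= /tau shQ.
by apply/ffunP => i; rewrite !ffunE/= add0r opprK -surjective_pairing.
Qed.

Lemma active_cdf (s t : R) (Q : cube d) : s <= t ->
  P (active s t Q) = (marginal_cdf P Q t - marginal_cdf P Q s)%:E.
Proof.
move=> st.
have mle u : measurable [set w : Omega R d | w Q <= u].
  by apply: sub_sigma_algebra; exists Q => //; exists [set` `]-oo, u]] => //=.
have finle u : P [set w : Omega R d | w Q <= u] \is a fin_num.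
  exact: fin_num_measure.
have -> : active s t Q = [set w : Omega R d | w Q <= t] `\` [set w | w Q <= s].
  apply/seteqP; split => w; rewrite /active/=; rewrite ltNge.
    by move=> /andP[/negP ? ?].
  by move=> [-> /negP ->].
rewrite measureD//; last by rewrite ltey_eq finle.
rewrite setIidr; last by move=> w /= /le_trans; exact.
by rewrite EFinB !fineK.
Qed.

Lemma small_activation (p : R) : 0 < p -> exists m, forall (k : 'I_m.+1) (Q : cube d),
  (P (active (k%:R / m.+1%:R) (k.+1%:R / m.+1%:R)  Q) <= p%:E)%E.
Proof.
move=> p0.
have : \forall m \near \oo, forall b : {ffun 'I_d -> bool},
    forall x, x \in `[0, 1] -> forall y, y \in `[0, 1] ->
    `|x - y| <= m.+1%:R^-1 ->
    `|marginal_cdf P (mkcube 0 b) x - marginal_cdf P (mkcube 0 b) y| <= p.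
  by apply: filter_forall => b; exact: within_itv_unif_continuous.
move=> [m _ /(_ m (leqnn _)) Hm]; exists m => k Q.
have m0 : 0 < m.+1%:R :> R by rewrite ltr0n.
rewrite active_cdf; last by rewrite ler_pM2r ?invr_gt0// ler_nat.
rewrite lee_fin marginal_cdf_base (le_trans (ler_norm _))//; apply: Hm.
- by rewrite in_itv/= divr_ge0//= ler_pdivrMr// mul1r ler_nat.
- by rewrite in_itv/= divr_ge0//= ler_pdivrMr// mul1r ler_nat ltnW.
- by rewrite -mulrBl -natrB// subSnn mul1r ger0_norm// invr_ge0.
Qed.

Lemma beta_n_cell_variation q (e : R) : 0 < e -> exists m, forall k : 'I_m.+1,
  {ae P, forall w, \forall n \near \oo, forall t,
     k%:R / m.+1%:R <= t -> t <= k.+1%:R / m.+1%:R ->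
     `| (beta_n q w n t)%:R / vol_Lambda R d n -
        (beta_n q w n (k%:R / m.+1%:R))%:R / vol_Lambda R d n | <= e}.
Proof.
move=> e0; pose lam := e / 24 ^+ d; pose p := lam / (2 * 8 ^+ d).
have lam0 : 0 < lam by rewrite divr_gt0// exprn_gt0.
have p0 : 0 < p by rewrite divr_gt0// mulr_gt0// exprn_gt0.
have plam : 8 ^+ d * p < lam.
  have -> : 8 ^+ d * p = lam / 2 by rewrite /p; field; rewrite expf_neq0.
  by lra.
have [m Hm] := small_activation p0; exists m => k.
have := ae_hits_le Pstat (Hm k) Perg plam.
set s := k%:R / _; set u := k.+1%:R / _.
apply: filterS => w Hw.
near=> n => t st tu.
have n0 : (0 < n)%N by near: n; exists 1%N.
have Hn1 : (\sum_(y <- grid d n.+1) activations w s u y)%:R <=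
    2 ^+ d * lam * (n.+1.*2.+1 ^ d)%:R.
  near: n; case: Hw => N _ HN; exists N => // n /= Nn; apply: HN => /=.
  exact: leqW.
have V0 : 0 < vol_Lambda R d n by rewrite exprn_gt0// mulr_gt0// ltr0n.
rewrite -mulrBl normrM [X in _ * X]gtr0_norm ?invr_gt0// ler_pdivrMr//.
apply: (le_trans (beta_n_variation q w n st)).
rewrite natrM natrX.
apply: (@le_trans _ _ (4 ^+ d * (2 ^+ d * lam * (n.+1.*2.+1 ^ d)%:R))).
  rewrite ler_wpM2l ?exprn_ge0//; apply: le_trans Hn1; rewrite ler_nat.
  by apply: leq_sum => y _; exact: le_activations.
have -> : e = 24 ^+ d * lam by rewrite /lam mulrC divfK// expf_neq0.
have nV : (n.+1.*2.+1 ^ d)%:R <= 3 ^+ d * vol_Lambda R d n.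
  rewrite /vol_Lambda -exprMn -!natrM -natrX ler_nat.
  by case: d => // d'; rewrite leq_exp2r//; lia.
have -> : 24 ^+ d = 4 ^+ d * 2 ^+ d * 3 ^+ d :> R.
  by rewrite -!exprMn; congr (_ ^+ _); ring.
set a := 4 ^+ d; set b := 2 ^+ d; set c := 3 ^+ d.
have -> : a * b * c * lam * vol_Lambda R d n = a * (b * lam * (c * vol_Lambda R d n)).
  by ring.
by rewrite !ler_wpM2l ?mulr_ge0 ?exprn_ge0// ltW.
Unshelve. all: by end_near.
Qed.

Lemma ae_beta_n_unif q (beta_hat : R -> R) (e : R) : 0 < e ->
  (forall t, t \in `[0, 1] ->
     {ae P, forall w, (beta_n q w n t)%:R / vol_Lambda R d n
                        @[n --> \oo] --> beta_hat t}) ->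
  {ae P, forall w, \forall n \near \oo, forall t, t \in `[0, 1] ->
     `| (beta_n q w n t)%:R / vol_Lambda R d n - beta_hat t | <= e}.
Proof.
move=> e0 cvg_hat; have e3 : 0 < e / 3 by rewrite divr_gt0.
have [m Hm] := beta_n_cell_variation q e3.
pose s (k : 'I_m.+1) : R := k%:R / m.+1%:R.
have m0 : 0 < m.+1%:R :> R by rewrite ltr0n.
have s01 k : s k \in `[0, 1].
  by rewrite in_itv/= divr_ge0//= ler_pdivrMr// mul1r ler_nat ltnW.
have aeF : ProperFilter (almost_everywhere P).
  apply: ae_properfilter_algebraOfSetsType.
  by apply: (@lt_le_trans _ _ 1%E); rewrite ?lte01// -(probability_setT P).
(* The limit inherits the oscillation bound on a cell: for fixed [t] the three almost sure events
   share an outcome, along which one passes to the limit. The exceptional set may depend on [t],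
   since [beta_hat] is non-random. *)
have hat_cell (k : 'I_m.+1) t : t \in `[0, 1] -> s k <= t -> t <= k.+1%:R / m.+1%:R ->
    `|beta_hat t - beta_hat (s k)| <= e / 3.
  move=> t01 st tu.
  have [w [[ct cs] Hw]] := filter_ex
    (filterI (filterI (cvg_hat t t01) (cvg_hat _ (s01 k))) (Hm k)).
  have cd : `|(beta_n q w n t)%:R / vol_Lambda R d n -
      (beta_n q w n (s k))%:R / vol_Lambda R d n| @[n --> \oo] -->
      `|beta_hat t - beta_hat (s k)|.
    by apply: cvg_norm; exact: cvgB ct cs.
  rewrite -(cvg_lim _ cd)//; apply: limr_le; first by apply/cvg_ex; eexists; exact: cd.
  by apply: filterS Hw => n; apply.
have Hk (k : 'I_m.+1) : {ae P, forall w,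
     \forall n \near \oo, (forall t, s k <= t -> t <= k.+1%:R / m.+1%:R ->
      `| (beta_n q w n t)%:R / vol_Lambda R d n -
        (beta_n q w n (s k))%:R / vol_Lambda R d n | <= e / 3) /\
      `| (beta_n q w n (s k))%:R / vol_Lambda R d n - beta_hat (s k) | <= e / 3}.
  apply: filterS2 (Hm k) (cvg_hat _ (s01 k)) => w Hw cvgw.
  have cw : \forall n \near \oo,
      `|beta_hat (s k) - (beta_n q w n (s k))%:R / vol_Lambda R d n| <= e / 3.
    by move/cvgrPdist_le : cvgw; apply.
  apply: filterS (filterI Hw cw) => n [h1 h2]; split => //.
  by rewrite distrC.
have aeFl : Filter (almost_everywhere P) by exact: aeF.
(* Only the finitely many grid points contribute exceptional null sets and thresholds for [n]. *)
apply: filterS (filter_forall (F := almost_everywhere P) aeFl Hk) => w Hw.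
apply: filterS (filter_forall (F := \oo) _ Hw) => n Hn t t01.
have [k st tu] := unit_itv_cell m t01.
have [h1 h2] := Hn k; have := h1 _ st tu; have := hat_cell k t t01 st tu.
move: h2; set x := _ / _; set y := _ / _ => h2 h3 h4.
have -> : y - beta_hat t = (y - x) + (x - beta_hat (s k)) - (beta_hat t - beta_hat (s k)).
  by ring.
rewrite (le_trans (ler_normB _ _))//.
have := ler_normD (y - x) (x - beta_hat (s k)); lra.
Qed.

End uniform.

Theorem theorem2p9 (R : realType) (d : nat) (P : probability (Omega R d) R)
  (q : nat) (beta_hat : R -> R) :
  P (@unit_configs R d) = 1%E ->
  stationary P -> ergodic P ->
  (q < d)%N ->
  (forall t, t \in `[0, 1] ->
     {ae P, forall w, (fun n => (beta_n q w n t)%:R / @vol_Lambda R d n)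
                        @ \oo --> beta_hat t}) ->
  (forall Q : cube d, {within `[0, 1], continuous (marginal_cdf P Q)}) ->
  {ae P, forall w,
     (fun n => ereal_sup [set (`| (beta_n q w n t)%:R / @vol_Lambda R d n
                                  - beta_hat t |)%:E | t in `[0, 1]])
       @ \oo --> 0%E}.
Proof.
move=> _ Pstat Perg _ cvg_hat cdf_cont.
(* Countably many tolerances [1/(j+1)] keep the exceptional set null. *)
have : {ae P, forall w, forall j : nat, \forall n \near \oo, forall t, t \in `[0, 1] ->
    `| (beta_n q w n t)%:R / vol_Lambda R d n - beta_hat t | <= j.+1%:R^-1}.
  by apply: ae_foralln => j; exact: ae_beta_n_unif.
apply: filterS => w Hw.
have sup_le e : 0 < e -> \forall n \near \oo,
    (0%E <= ereal_sup [set (`| (beta_n q w n t)%:R / vol_Lambda R d n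
                            - beta_hat t |)%:E | t in `[0%R, 1%R]] <= e%:E)%E.
  move=> e0; have [j _ /(_ j (leqnn _))/= je] := near_infty_natSinv_lt (PosNum e0).
  apply: filterS (Hw j) => n Hn; apply/andP; split.
    (* The point [t = 0] shows that the supremum is over a nonempty set, hence nonnegative. *)
    apply: ereal_sup_ge; exists (`| (beta_n q w n 0)%:R / vol_Lambda R d n
                            - beta_hat 0 |)%:E; last by rewrite lee_fin.
    by exists 0 => //=; rewrite in_itv/= lexx ler01.
  apply: ub_ereal_sup => _ [t /= t01 <-]; rewrite lee_fin.
  exact: le_trans (Hn t t01) (ltW je).
apply/fine_cvgP; split.
  apply: filterS (sup_le 1 ltr01) => n /andP[h0 h1].
  by rewrite ge0_fin_numE// (le_lt_trans h1)// ltry.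
apply/cvgrPdist_le => e e0; apply: filterS (sup_le e e0) => n /andP[h0 h1] /=.
rewrite sub0r normrN ger0_norm ?fine_ge0// -lee_fin fineK//.
by rewrite ge0_fin_numE// (le_lt_trans h1)// ltry.
Qed.
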